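(* Let $R$ be a weakly reversible ring. Then $R[x]$ is a zip ring if, and only if, $R$ is a zip ring.
   Context: All rings are associative with identity, not necessarily commutative. In $R[x]$ the indeterminate $x$ commutes with the elements of $R$. For a subset $X$ of a ring $S$, $r_S(X)=\{s\in S: Xs=0\}$ and $l_S(X)=\{s\in S: sX=0\}$. An element $a\in R$ is reversible if $l_R(a)=r_R(a)$. A ring $R$ is weakly reversible if for each non-zero $a\in R$ there is an integer $m>0$ such that $a^m$ is a non-zero reversible element of $R$. A ring $S$ is right (resp. left) zip if for every subset $X\subseteq S$ with $r_S(X)=0$ (resp. $l_S(X)=0$) there is a finite subset $Y\subseteq X$ with $r_S(Y)=0$ (resp. $l_S(Y)=0$); $S$ is zip if it is both right and left zip. *)

(* Defs.v *)
From HB Require Import structures.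
From mathcomp Require Import all_boot all_order all_algebra.
From mathcomp Require Import boolp classical_sets cardinality.

Set Implicit Arguments.
Unset Strict Implicit.
Unset Printing Implicit Defensive.

Import GRing.Theory.
Local Open Scope classical_set_scope.
Local Open Scope ring_scope.

Definition r_ann (S : nzRingType) (X : set S) : set S :=
  [set s | forall x, X x -> x * s = 0].

Definition l_ann (S : nzRingType) (X : set S) : set S :=
  [set s | forall x, X x -> s * x = 0].

Definition reversible_elt (R : nzRingType) (a : R) : Prop :=
  l_ann [set a] = r_ann [set a].

Definition weakly_reversible (R : nzRingType) : Prop :=
  forall a : R, a <> 0 ->
    exists m : nat, [/\ (0 < m)%N, a ^+ m <> 0 & reversible_elt (a ^+ m)].

Definition right_zip (S : nzRingType) : Prop :=
  forall X : set S, r_ann X = [set 0] ->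
    exists Y : set S, [/\ finite_set Y, Y `<=` X & r_ann Y = [set 0]].

Definition left_zip (S : nzRingType) : Prop :=
  forall X : set S, l_ann X = [set 0] ->
    exists Y : set S, [/\ finite_set Y, Y `<=` X & l_ann Y = [set 0]].

Definition zip_ring (S : nzRingType) : Prop := right_zip S /\ left_zip S.

(* Main.v *)
(* A zip condition passes between R and R[x] once R is McCoy: finitely many
   polynomials are concatenated into a single f, and if f g = 0 with g <> 0 then
   some non-zero constant c satisfies f c = 0.
   To find c, take g of minimal degree, with constant term b. If b is not
   nilpotent, then f b^n = 0 for some n, because the annihilator of a reversible
   power of b is a two-sided ideal. If b is nilpotent, multiply g on the right by
   a power of b to get b^2 = 0. In a weakly reversible ring every element of
   square zero is reversible; with minimality this makes all coefficients of g
   reversible, and then f g = 0 forces every coefficient of f to kill every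
   coefficient of g. The left-hand statements follow by passing to the opposite
   ring. *)
Require Import Defs.
From HB Require Import structures.
From mathcomp Require Import all_boot all_order all_algebra.
From mathcomp Require Import boolp classical_sets cardinality.

Import GRing.Theory.

Local Open Scope ring_scope.

(** * Reversible elements and the right McCoy property *)

Section Reversible.
Set Implicit Arguments.
Unset Strict Implicit.
Variable R : nzRingType.
Implicit Types a b r : R.

Lemma reversible_mulC a : reversible_elt a ->
  forall r, r * a = 0 <-> a * r = 0.
Proof.
move=> rev r; have E : l_ann [set a]%classic r = r_ann [set a]%classic r.
  by rewrite rev.
split=> h.
- have : r_ann [set a]%classic r by rewrite -E => x ->.
  exact.
- have : l_ann [set a]%classic r by rewrite E => x ->.
  exact.
Qed.

Lemma mulC_reversible a : (forall r, r * a = 0 <-> a * r = 0) ->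
  reversible_elt a.
Proof.
move=> h; apply/seteqP; split=> r rP x ->; apply/h; exact: rP.
Qed.

Lemma reversible_insert a b : reversible_elt b -> a * b = 0 ->
  forall r, a * r * b = 0.
Proof.
move=> /reversible_mulC rev ab0 r.
by apply/rev; rewrite mulrA; have /rev -> := ab0; rewrite mul0r.
Qed.

Hypothesis hR : weakly_reversible R.

(** Powers of [a] past the first vanish, so for non-zero [a] weak reversibility can only supply the
    exponent 1. *)
Lemma sqr0_reversible a : a * a = 0 -> reversible_elt a.
Proof.
move=> a2; have [->|/eqP/hR [[|[|m]] [m_gt0 am rev]]] := eqVneq a 0.
- by apply: mulC_reversible => r; rewrite mulr0 mul0r.
- by [].
- by rewrite expr1 in rev.
- by case: am; rewrite !exprS mulrA a2 mul0r.
Qed.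

Lemma right_McCoy_nonnilpotent (f g : {poly R}) : f * g = 0 ->
  (forall n, g`_0 ^+ n != 0) -> exists2 c, c != 0 & forall i, f`_i * c = 0.
Proof.
move=> fg0 nnil; set b := g`_0.
suff [n nP] : exists n, forall i, (i < size f)%N -> f`_i * b ^+ n = 0.
  exists (b ^+ n) => // i; case: (ltnP i (size f)) => [/nP //|lefi].
  by rewrite nth_default ?mul0r.
elim: (size f) => [|k [n IH]]; first by exists 0%N.
have [m [m_gt0 _ rev]] := hR (elimN eqP (nnil n)).
have {}IH i : (i < k)%N -> f`_i * (b ^+ n) ^+ m = 0.
  by case: m m_gt0 {rev} => // m _ /IH fi; rewrite exprS mulrA fi mul0r.
(* In coefficient [k] of [f * g], multiplied by [(b ^+ n) ^+ m], the terms with [i < k] vanish by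
   [reversible_insert]; the last term carries one further [b], hence the successor. *)
exists (n * m).+1 => i; rewrite ltnS leq_eqVlt => /predU1P [->{i}|/IH fi]; last first.
  by rewrite exprSr exprM mulrA fi mul0r.
have /(congr1 (fun p : {poly R} => p`_k * (b ^+ n) ^+ m)) := fg0.
rewrite coef0 mul0r coefM mulr_suml big_ord_recr /= subnn big1 ?add0r.
  by rewrite exprS exprM mulrA.
by move=> i _; apply: reversible_insert => //; apply: IH.
Qed.

(* The hypothesis on [g] says that no [g * r] loses its constant term without
   vanishing, as is the case when [g] has minimal degree among the non-zero
   polynomials annihilated by [f]. *)
Lemma coef_annihilator_sqr0 (f g : {poly R}) : f * g = 0 ->
  (forall r, g`_0 * r = 0 -> forall j, g`_j * r = 0) ->
  g`_0 * g`_0 = 0 -> forall i j, f`_i * g`_j = 0.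
Proof.
move=> fg0 gP b2.
have rev0 := reversible_mulC (sqr0_reversible b2).
(* [gP] turns a left factor from the constant term into any coefficient; reversibility of the
   constant term then swaps the factors so that [gP] reaches the other one. *)
have gg i j : g`_i * g`_j = 0.
  by apply/gP/rev0/gP.
have rev j := reversible_mulC (sqr0_reversible (gg j j)).
elim/ltn_ind => i IH.
have fi0 : f`_i * g`_0 = 0.
  have /(congr1 (fun p : {poly R} => p`_i)) := fg0.
  rewrite coef0 coefM big_ord_recr /= subnn big1 ?add0r // => k _.
  exact: IH.
by move=> j; apply/rev/gP/rev.
Qed.

Lemma right_McCoy (f g : {poly R}) : f * g = 0 -> g != 0 ->
  exists2 c, c != 0 & forall i, f`_i * c = 0.
Proof.
have [n] := ubnP (size g); elim: n g => // n IH g /ltnSE size_g fg0 g0.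
have [gP|/existsNP [r /not_implyP [gr0 /existsNP [j /eqP grj]]]] :=
    pselect (forall r, g`_0 * r = 0 -> forall j, g`_j * r = 0); last first.
  (* [g * r%:P] is non-zero without constant term; dividing it by ['X] gives a smaller polynomial
     still annihilated by [f]. *)
  pose h := \poly_(k < (size g).-1) (g`_k.+1 * r).
  have size_g_gt0 : (0 < size g)%N by rewrite size_poly_gt0.
  have hX : h * 'X = g * r%:P.
    apply/polyP=> [[|k]]; rewrite coefMX coefMC //=.
    rewrite coef_poly ltn_predRL; case: ltnP => // leg.
    by rewrite nth_default ?mul0r.
  apply: (IH h).
  - by apply: leq_trans size_g; rewrite -(prednK size_g_gt0) ltnS size_poly.
  - apply: (@monic_rreg _ 'X (monicX R)).
    by rewrite -mulrA hX mulrA fg0 !mul0r.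
  - apply: contraNneq grj => h0.
    by rewrite -coefMC -hX h0 mul0r coef0.
have [nnil|] := pselect (forall n, g`_0 ^+ n != 0).
  exact: right_McCoy_nonnilpotent nnil.
move=> /existsNP [k /negP/negPn bk0].
have [g00|g00] := eqVneq g`_0 0.
  by case/eqP: g0; apply/polyP=> j; rewrite -[g`_j]mulr1 gP ?coef0 // g00 mul0r.
have ex : exists k, g`_0 ^+ k == 0 by exists k.
case: (ex_minnP ex) => [[|[|m]]] bm minm.
- by rewrite expr0 oner_eq0 in bm.
- by rewrite expr1 (negPf g00) in bm.
have bm1 : g`_0 ^+ m.+1 != 0.
  by apply/negP => /minm; rewrite ltnn.
exists (g`_0 ^+ m.+1) => // i.
(* As [m.+2] is the least vanishing exponent, the constant term of [h] is non-zero and its square is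
   zero. *)
pose h := g * (g`_0 ^+ m)%:P.
have h0 : h`_0 = g`_0 ^+ m.+1 by rewrite coefMC -exprS.
rewrite -h0; apply: coef_annihilator_sqr0.
- by rewrite mulrA fg0 mul0r.
- by move=> r; rewrite coefMC -mulrA => /gP gr k'; rewrite coefMC -mulrA.
- by rewrite h0 -exprD addSnnS exprD (eqP bm) mulr0.
Qed.

End Reversible.

(** * Right zip transfer between [R] and [{poly R}] *)

Section Transfer.
Set Implicit Arguments.
Unset Strict Implicit.
Local Open Scope classical_set_scope.

Lemma r_ann_eq0 (S : nzRingType) (X : set S) :
  r_ann X = [set 0] <-> forall s, r_ann X s -> s = 0.
Proof.
split=> [-> //|X0]; apply/seteqP; split=> [s /X0 //|_ -> x _].
exact: mulr0.
Qed.

Lemma l_ann_eq0 (S : nzRingType) (X : set S) :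
  l_ann X = [set 0] <-> forall s, l_ann X s -> s = 0.
Proof.
split=> [-> //|X0]; apply/seteqP; split=> [s /X0 //|_ -> x _].
exact: mul0r.
Qed.

(** Constants act coefficientwise, so [X] can be moved into [{poly R}]; constant terms bring the
    finite subset back. *)
Lemma right_zip_of_poly (R : nzRingType) : right_zip {poly R} -> right_zip R.
Proof.
move=> zipP X /r_ann_eq0 X0.
have /zipP [Y [finY YX /r_ann_eq0 Y0]] : r_ann (polyC @` X) = [set 0].
  apply/r_ann_eq0 => g gX; apply/polyP=> i; rewrite coef0; apply: X0 => x Xx.
  by rewrite -coefCM gX ?coef0 //; exists x.
exists ((fun p : {poly R} => p`_0) @` Y); split.
- exact: finite_image.
- by move=> _ [p /YX [x Xx <-] <-]; rewrite coefC.
- apply/r_ann_eq0 => s sY; apply: polyC_inj; apply: Y0 => p Yp.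
  have [x _ def_p] := YX p Yp.
  rewrite -def_p -polyCM; congr _%:P; apply: sY.
  by exists p => //; rewrite -def_p coefC.
Qed.

(* Shifting the members of [s] so that their supports become disjoint. *)
Lemma concat_poly_seq (R : nzRingType) (s : seq {poly R}) : exists f : {poly R},
  (forall g, (forall h, h \in s -> h * g = 0) -> f * g = 0) /\
  (forall c, (forall i, f`_i * c = 0) -> forall h, h \in s -> forall i, h`_i * c = 0).
Proof.
elim: s => [|h s [f [fP fc]]]; first by exists 0; split=> // g _; rewrite mul0r.
exists (h + f * 'X^(size h)); split=> [g gP|c hc k].
  rewrite mulrDl gP ?mem_head // add0r -mulrA -commr_polyXn mulrA fP ?mul0r //.
  by move=> k ks; rewrite gP // inE ks orbT.
rewrite inE => /predU1P [->{k} i|]; last first.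
  apply: fc => i; have := hc (i + size h)%N.
  by rewrite coefD coefMXn nth_default ?leq_addl // ltnNge leq_addl add0r addnK.
have := hc i; rewrite coefD coefMXn; case: ltnP => [_|lei _].
  by rewrite addr0.
by rewrite nth_default ?mul0r.
Qed.

Lemma right_zip_poly (R : nzRingType) : weakly_reversible R ->
  right_zip R -> right_zip {poly R}.
Proof.
move=> hR zipR X /r_ann_eq0 X0.
pose C := [set c : R | exists2 f : {poly R}, X f & exists i, c = f`_i].
have /zipR [D [finD DC /r_ann_eq0 D0]] : r_ann C = [set 0].
  apply/r_ann_eq0 => c cC; apply: polyC_inj; apply: X0 => f Xf.
  apply/polyP=> i; rewrite coefMC coef0; apply: cC.
  by exists f => //; exists i.
(* [F] picks a member of [X] having the given element of [C] as a coefficient, with default 0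
   outside [C]. *)
have /choice [F FP] : forall c, exists f : {poly R},
    C c -> X f /\ exists i, c = f`_i.
  move=> c; have [[f Xf fc]|nC] := pselect (C c); first by exists f.
  by exists 0.
have finFD := finite_image F finD.
exists (F @` D); split=> //.
  by move=> _ [c /DC /FP [XFc _] <-].
apply/r_ann_eq0 => g gP; apply/eqP/negPn/negP => g0.
have [s sP] := (finite_seqP _).1 finFD.
have [f [fP fc]] := concat_poly_seq s.
have fg0 : f * g = 0.
  by apply: fP => h hs; apply: gP; rewrite sP.
(* This [c] is killed by every coefficient of the chosen polynomials, in particular by all of
   [D]. *)
have [c /eqP c0 cP] := right_McCoy hR fg0 g0.
apply: c0; apply: D0 => d Dd; have [_ [i ->]] := FP d (DC d Dd).
apply: fc => //.
have : (F @` D) (F d) by exists d.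
by rewrite sP.
Qed.

End Transfer.

(** * Left-hand versions through the opposite ring *)

Section Converse.
Set Implicit Arguments.
Unset Strict Implicit.
Local Open Scope classical_set_scope.

(** Reversing products, [phi] carries left annihilators to right ones; [psi] pulls the finite subset
    back. *)
Lemma right_zip_anti (S T : nzRingType) (phi : S -> T) (psi : T -> S) :
  cancel phi psi -> cancel psi phi -> phi 0 = 0 ->
  (forall x y, phi (x * y) = phi y * phi x) -> right_zip T -> left_zip S.
Proof.
move=> phiK psiK phi0 phiM zipT X /l_ann_eq0 X0.
have /zipT [Y [finY YX /r_ann_eq0 Y0]] : r_ann (phi @` X) = [set 0].
  apply/r_ann_eq0 => t tX; rewrite -(psiK t) -phi0; congr phi; apply: X0 => x Xx.
  by apply: (can_inj phiK); rewrite phiM psiK phi0 tX //; exists x.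
exists (psi @` Y); split; first exact: finite_image.
  by move=> _ [y /YX [x Xx <-] <-]; rewrite phiK.
apply/l_ann_eq0 => s sY; apply: (can_inj phiK); rewrite phi0; apply: Y0 => y Yy.
by rewrite -[y]psiK -phiM sY //; exists y.
Qed.

Lemma left_zip_anti (S T : nzRingType) (phi : S -> T) (psi : T -> S) :
  cancel phi psi -> cancel psi phi -> phi 0 = 0 ->
  (forall x y, phi (x * y) = phi y * phi x) -> left_zip T -> right_zip S.
Proof.
move=> phiK psiK phi0 phiM zipT X /r_ann_eq0 X0.
have /zipT [Y [finY YX /l_ann_eq0 Y0]] : l_ann (phi @` X) = [set 0].
  apply/l_ann_eq0 => t tX; rewrite -(psiK t) -phi0; congr phi; apply: X0 => x Xx.
  by apply: (can_inj phiK); rewrite phiM psiK phi0 tX //; exists x.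
exists (psi @` Y); split; first exact: finite_image.
  by move=> _ [y /YX [x Xx <-] <-]; rewrite phiK.
apply/r_ann_eq0 => s sY; apply: (can_inj phiK); rewrite phi0; apply: Y0 => y Yy.
by rewrite -[y]psiK -phiM sY //; exists y.
Qed.

Lemma weakly_reversible_converse (R : nzRingType) :
  weakly_reversible R -> weakly_reversible R^c.
Proof.
by move=> hR a /hR [m [m_gt0 am rev]]; exists m; rewrite revrX.
Qed.

Definition poly_converse (R : nzRingType) (p : {poly R}) : {poly R^c} :=
  \poly_(i < size p) (p`_i : R^c).

Definition poly_unconverse (R : nzRingType) (p : {poly R^c}) : {poly R} :=
  \poly_(i < size p) (p`_i : R).

Variable R : nzRingType.

Lemma coef_poly_converse (p : {poly R}) i : (poly_converse p)`_i = p`_i.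
Proof. by rewrite coef_poly; case: ltnP => // /(nth_default 0) ->. Qed.

Lemma coef_poly_unconverse (p : {poly R^c}) i : (poly_unconverse p)`_i = p`_i.
Proof. by rewrite coef_poly; case: ltnP => // /(nth_default 0) ->. Qed.

Lemma poly_converseK : cancel (@poly_converse R) (@poly_unconverse R).
Proof.
by move=> p; apply/polyP=> i; rewrite coef_poly_unconverse coef_poly_converse.
Qed.

Lemma poly_unconverseK : cancel (@poly_unconverse R) (@poly_converse R).
Proof.
by move=> p; apply/polyP=> i; rewrite coef_poly_converse coef_poly_unconverse.
Qed.

Lemma poly_converse0 : poly_converse (0 : {poly R}) = 0.
Proof. by apply/polyP=> i; rewrite coef_poly_converse !coef0. Qed.

(** [coefMr] indexes the convolution from the other end, so the two sums agree term by term. *)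
Lemma poly_converseM (p q : {poly R}) :
  poly_converse (p * q) = poly_converse q * poly_converse p.
Proof.
apply/polyP=> i; rewrite coef_poly_converse coefM coefMr.
by apply: eq_bigr => j _; rewrite !coef_poly_converse.
Qed.

Lemma poly_unconverse0 : poly_unconverse (0 : {poly R^c}) = 0.
Proof. by rewrite -poly_converse0 poly_converseK. Qed.

Lemma poly_unconverseM (p q : {poly R^c}) :
  poly_unconverse (p * q) = poly_unconverse q * poly_unconverse p.
Proof.
by rewrite -[in LHS](poly_unconverseK p) -[in LHS](poly_unconverseK q)
  -poly_converseM poly_converseK.
Qed.

Lemma left_zip_converse : left_zip R <-> right_zip R^c.
Proof.
split.
- exact: (@left_zip_anti R^c R id id).
- exact: (@right_zip_anti R R^c id id).
Qed.

Lemma left_zip_poly_converse : left_zip {poly R} <-> right_zip {poly R^c}.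
Proof.
split.
- exact: (left_zip_anti poly_unconverseK poly_converseK poly_unconverse0
    poly_unconverseM).
- exact: (right_zip_anti poly_converseK poly_unconverseK poly_converse0
    poly_converseM).
Qed.

End Converse.

Theorem corollary2p20 (R : nzRingType) (hR : weakly_reversible R) :
  zip_ring {poly R} <-> zip_ring R.
Proof.
have hRc := weakly_reversible_converse hR.
split=> -[zipr zipl]; split.
- exact: right_zip_of_poly zipr.
- exact/left_zip_converse/right_zip_of_poly/left_zip_poly_converse.
- exact: right_zip_poly hR zipr.
- exact/left_zip_poly_converse/(right_zip_poly hRc)/left_zip_converse.
Qed.
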